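(* Let $G \subseteq W = (\mathbb{Z}/2\mathbb{Z})^4 \rtimes S_5$ and let $\alpha:=\iota_{\mathrm{Pic}}(\overline{[e_i]+[e_j]})\in H^1(G,\mathfrak{P})$ be a $2$-torsion class of type II. Let $H\subset G$ be the stabiliser of $i$ under the operation of $p(G)$ on $\{1,\ldots,5\}$. Then: (i) $H\subset G$ is a subgroup of index $2$. (ii) One has $\alpha=\mathrm{cores}_H^G\,\iota_{\mathrm{Pic}}^H(\overline{[e_i]})$, where $\mathrm{cores}_H^G\colon H^1(H,\mathfrak{P})\to H^1(G,\mathfrak{P})$ is the corestriction.
   Context: $W = (\mathbb{Z}/2\mathbb{Z})^4 \rtimes S_5$, where $(\mathbb{Z}/2\mathbb{Z})^4$ denotes $\{(a_1,\ldots,a_5) \in (\mathbb{Z}/2\mathbb{Z})^5 \mid a_1+\cdots+a_5=0\}$, acted upon by $S_5$ by permuting coordinates. $P$ is the free abelian group on the symbols $[e_1],\ldots,[e_5]$, and $\mathfrak{P} \subset P\otimes_{\mathbb{Z}}\mathbb{Q}$ is the subgroup generated by $P$ and the element $\frac12([e_1]+\cdots+[e_5])$. The group $W$ acts on $\mathfrak{P}$: $S_5$ permutes the indices and $(a_1,\ldots,a_5)$ sends $[e_i]$ to $(-1)^{a_i}[e_i]$. $p\colon W\to S_5$ is the natural projection. For a subgroup $K\subseteq W$, $\iota^K_{\mathrm{Pic}}\colon(\mathfrak{P}/2\mathfrak{P})^K\to H^1(K,\mathfrak{P})_2$ (written $\iota_{\mathrm{Pic}}$ when $K=G$) is the connecting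 homomorphism of $0\to\mathfrak{P}\xrightarrow{\cdot2}\mathfrak{P}\to\mathfrak{P}/2\mathfrak{P}\to0$, i.e. $\overline{c}$ is sent to the class of $\sigma\mapsto\frac12(\sigma(c)-c)$. A $2$-torsion class of type II in $H^1(G,\mathfrak{P})$ is a nonzero element of the form $\iota_{\mathrm{Pic}}(\overline{[e_i]+[e_j]})$, where $\{i,j\}\subset\{1,\ldots,5\}$ is a $p(G)$-orbit of length two. *)

(* Defs.v *)
From HB Require Import structures.
From mathcomp Require Import all_boot all_order all_algebra all_fingroup.
From mathcomp Require Import boolp.

(******************************************************************************)
(* First cohomology of subgroups of a finite group, and the W(D_5)-module     *)
(* generated by [e_1], ..., [e_5] and ([e_1] + ... + [e_5]) / 2.              *)
(*                                                                            *)
(* Conventions. In MathComp the product s * t of two permutations means s     *)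
(* first and then t, and groups act on the right. All modules below are       *)
(* therefore right modules, and a cocycle satisfies                           *)
(*   f (x * y) = (f x) . y + f y.                                             *)
(* If one writes the product of maps in the functional order, so that x * y   *)
(* becomes y o x, this is the usual left module and the usual cocycle         *)
(* identity f (y o x) = y (f x) + f y: the group elements, the maps by which  *)
(* they act, the cocycles and the coboundaries are unchanged.                 *)
(******************************************************************************)

Set Implicit Arguments.
Unset Strict Implicit.
Unset Printing Implicit Defensive.

Import GRing.Theory.
Local Open Scope ring_scope.
Local Open Scope quotient_scope.

Record gmodule (gT : finGroupType) (M : zmodType) := GModule {
  gmod_act :> M -> gT -> M;
  gmodD : forall g, {morph gmod_act^~ g : x y / x + y};
  gmod1 : forall m, gmod_act m 1%g = m;
  gmodM : forall m x y, gmod_act m (x * y)%g = gmod_act (gmod_act m x) y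
}.

Section Cohomology.

Variables (gT : finGroupType) (M : zmodType) (to : gmodule gT M).
Implicit Types (K G H : {group gT}) (m : M) (f : {ffun gT -> M}).

Lemma gmod0 g : to 0 g = 0.
Proof. by apply: (addrI (to 0 g)); rewrite -gmodD !addr0. Qed.

Lemma gmodN g m : to (- m) g = - to m g.
Proof. by apply: (addrI (to m g)); rewrite -gmodD !subrr gmod0. Qed.

Lemma gmodB g m1 m2 : to (m1 - m2) g = to m1 g - to m2 g.
Proof. by rewrite gmodD gmodN. Qed.

Lemma gmod_sum g (I : Type) (r : seq I) (P : pred I) (F : I -> M) :
  to (\sum_(i <- r | P i) F i) g = \sum_(i <- r | P i) to (F i) g.
Proof. by elim/big_rec2: _ => [|i x y _ <-]; rewrite ?gmod0 ?gmodD. Qed.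

Definition H0 K : Type := {m : M | [forall g in K, to m g == m]}.

(* Cochains on K are functions on the whole of gT vanishing outside K (as for *)
(* class functions), so that two cocycles on K are equal iff they agree on K. *)
Definition cocycle_pred K : {pred {ffun gT -> M}} :=
  [pred f : {ffun gT -> M} |
     [forall x in K, forall y in K, f (x * y)%g == to (f x) y + f y] &&
     [forall x, (x \notin K) ==> (f x == 0)]].

Lemma cocycleP K f :
  reflect ({in K &, forall x y, f (x * y)%g = to (f x) y + f y}
           /\ (forall x, x \notin K -> f x = 0))
          (f \in cocycle_pred K).
Proof.
apply: (iffP andP) => [[fM f0]|[fM f0]]; split.
- move=> x y Kx Ky; apply/eqP.
  by move/forall_inP/(_ x Kx)/forall_inP/(_ y Ky): fM.
- by move=> x Kx; apply/eqP; apply: (implyP (forallP f0 x)).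
- by apply/forall_inP => x Kx; apply/forall_inP => y Ky; rewrite fM.
- by apply/forallP => x; apply/implyP => Kx; rewrite f0.
Qed.

Fact cocycle_zmod_closed K : zmod_closed (cocycle_pred K).
Proof.
split=> [|f1 f2 /cocycleP[f1M f10] /cocycleP[f2M f20]]; apply/cocycleP; split.
- by move=> x y _ _; rewrite !ffunE gmod0 addr0.
- by move=> x _; rewrite ffunE.
- move=> x y Kx Ky; rewrite !ffunE f1M // f2M // gmodB opprD.
  by rewrite addrACA.
- by move=> x Kx; rewrite !ffunE f10 // f20 // subr0.
Qed.

HB.instance Definition _ K := GRing.isZmodClosed.Build {ffun gT -> M}
  (cocycle_pred K) (cocycle_zmod_closed K).

Record Z1 K := Cocycle { Z1val :> {ffun gT -> M};
                         Z1valP : Z1val \in cocycle_pred K }.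
HB.instance Definition _ K := [isSub for @Z1val K].
HB.instance Definition _ K := [Choice of Z1 K by <:].
HB.instance Definition _ K := [SubChoice_isSubZmodule of Z1 K by <:].

Definition B1 K : {pred Z1 K} :=
  [pred f : Z1 K | `[< exists m, {in K, forall x, f x = to m x - m} >]].
Arguments B1 : clear implicits.

Lemma B1P K (f : Z1 K) :
  reflect (exists m, {in K, forall x, f x = to m x - m}) (f \in B1 K).
Proof. exact: asboolP. Qed.

Fact B1_zmod_closed K : zmod_closed (B1 K).
Proof.
split=> [|f1 f2 /B1P[m1 Dm1] /B1P[m2 Dm2]]; apply/B1P.
  by exists 0 => x _; rewrite ffunE gmod0 subrr.
exists (m1 - m2) => x Kx.
by rewrite !ffunE Dm1 // Dm2 // gmodB opprD addrACA -opprD.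
Qed.

HB.instance Definition _ K := GRing.isZmodClosed.Build (Z1 K) (B1 K)
  (B1_zmod_closed K).

Definition H1 K : zmodType := {ideal_quot (B1 K)}.

Definition cohom K (f : Z1 K) : H1 K := \pi f.

Lemma cohomP K (f1 f2 : Z1 K) :
  reflect (exists m, {in K, forall x, f1 x - f2 x = to m x - m})
          (cohom f1 == cohom f2).
Proof.
rewrite /cohom -Quotient.idealrBE; apply: (iffP (B1P _)) => -[m Dm];
  exists m => x Kx; have := Dm x Kx; rewrite !ffunE //.
Qed.

(* Corestriction, meaningful when H is a subgroup of G: t runs over           *)
(* representatives of the cosets t H, and if g t = t' h with h in H, then     *)
(*   (cores f) g = \sum_t (f h) . t^-1.                                       *)
(* This is the usual formula, with the sides exchanged for right modules.     *)
(* Cohomologous cocycles have cohomologous images (coresE), so cores does not *)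
(* depend on the representative of a used in its definition.                  *)
Section Corestriction.

Variables H G : {group gT}.

Definition lrep (x : gT) : gT := fingroup.repr (x *: H)%g.

Definition cores_fun (f : gT -> M) : {ffun gT -> M} :=
  [ffun g => if g \in G then
     \sum_(C in lcosets H G)
        let t := fingroup.repr C in
        to (f ((lrep (g * t))^-1 * (g * t))%g) (t^-1)%g
   else 0].

Lemma lrepP x : exists2 h, h \in H & lrep x = (x * h)%g.
Proof. by apply/lcosetP; apply: mem_repr (lcoset_refl H x). Qed.

Lemma lrepV_mem x : ((lrep x)^-1 * x)%g \in H.
Proof. by case: (lrepP x) => h Hh ->; rewrite invMg mulgKV groupV. Qed.

Lemma lrep_eq x y : (x *: H = y *: H)%g -> lrep x = lrep y.
Proof. by rewrite /lrep => ->. Qed.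

Lemma lcoset_lrep x : (lrep x *: H = x *: H)%g.
Proof. by case: (lrepP x) => h Hh ->; rewrite lcosetM lcoset_id. Qed.

Lemma lcosets_repr C : C \in lcosets H G -> (fingroup.repr C *: H)%g = C.
Proof. by case/lcosetsP=> x Gx ->; apply: lcoset_lrep. Qed.

Lemma sum_lcosetsM g (F : {set gT} -> M) : g \in G ->
  \sum_(C in lcosets H G) F (g *: C)%g = \sum_(C in lcosets H G) F C.
Proof.
move=> Gg; rewrite [RHS](reindex (fun C : {set gT} => (g *: C)%g)) /=.
  apply: eq_bigl => C; apply/idP/idP.
    by case/lcosetsP=> x Gx ->; apply/lcosetsP; exists (g * x)%g;
       rewrite ?groupM ?lcosetM.
  case/lcosetsP=> x Gx DC; apply/lcosetsP; exists (g^-1 * x)%g.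
    by rewrite groupM ?groupV.
  by rewrite lcosetM -DC lcosetK.
exists (fun C : {set gT} => (g^-1 *: C)%g) => C _; first exact: lcosetK.
exact: lcosetKV.
Qed.

Fact cores_cocycle (f : Z1 H) : cores_fun f \in cocycle_pred G.
Proof.
case: f => f /= /cocycleP[fM f0]; apply/cocycleP; split; last first.
  by move=> x Gx; rewrite ffunE (negPf Gx).
move=> x y Gx Gy; rewrite !ffunE Gx Gy groupM //= gmod_sum.
rewrite -[in RHS](sum_lcosetsM _ Gy) -big_split /=.
apply: eq_bigr => C GC; set t := fingroup.repr C.
have Dt : fingroup.repr (y *: C)%g = lrep (y * t).
  by rewrite -{1}(lcosets_repr GC) -lcosetM.
rewrite Dt; set t' := lrep (y * t). rewrite -gmodM.
have -> : lrep (x * t') = lrep (x * y * t).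
  by apply: lrep_eq; rewrite !lcosetM lcoset_lrep lcosetM.
set t2 := lrep _.
have Dh : (t'^-1 * y = (t'^-1 * (y * t)) * t^-1)%g by rewrite !mulgA mulgK.
have -> : (t2^-1 * (x * y * t) = (t2^-1 * (x * t')) * (t'^-1 * (y * t)))%g.
  by rewrite !mulgA mulgK.
rewrite fM ?lrepV_mem //.
  by rewrite gmodD -gmodM -Dh.
have -> : t2 = lrep (x * t').
  by apply: lrep_eq; rewrite !lcosetM lcoset_lrep lcosetM.
exact: lrepV_mem.
Qed.

Definition coresZ (f : Z1 H) : Z1 G := Cocycle (cores_cocycle f).

Definition cores (a : H1 H) : H1 G := cohom (coresZ (generic_quotient.repr a)).

Lemma coresE (f : Z1 H) : cores (cohom f) = cohom (coresZ f).
Proof.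
rewrite /cores; set f' := generic_quotient.repr _.
have /eqP/cohomP[m Dm] : cohom f' = cohom f by rewrite /cohom reprK.
apply/eqP/cohomP.
exists (\sum_(C in lcosets H G) to m (fingroup.repr C)^-1%g) => g Gg.
rewrite !ffunE Gg gmod_sum.
rewrite -[X in _ = X - _](sum_lcosetsM _ Gg) -!sumrB.
apply: eq_bigr => C GC; set t := fingroup.repr C.
have -> : fingroup.repr (g *: C)%g = lrep (g * t).
  by rewrite -{1}(lcosets_repr GC) -lcosetM.
rewrite /= -gmodB Dm ?lrepV_mem // gmodB -!gmodM; congr (to m _ - _).
by rewrite !mulgA mulgK.
Qed.

End Corestriction.

Definition dbl : {pred M} := [pred m | `[< exists n, m = n *+ 2 >]].

Lemma dblP m : reflect (exists n, m = n *+ 2) (m \in dbl).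
Proof. exact: asboolP. Qed.

Fact dbl_zmod_closed : zmod_closed dbl.
Proof.
split=> [|_ _ /dblP[n1 ->] /dblP[n2 ->]]; apply/dblP.
  by exists 0; rewrite mul0rn.
by exists (n1 - n2); rewrite mulrnBl.
Qed.

HB.instance Definition _ := GRing.isZmodClosed.Build M dbl
  dbl_zmod_closed.

Definition mod2 : zmodType := {ideal_quot dbl}.

Definition bar (m : M) : mod2 := \pi m.

Lemma barP m1 m2 : reflect (exists n, m1 - m2 = n *+ 2) (bar m1 == bar m2).
Proof. by rewrite /bar -Quotient.idealrBE; apply: dblP. Qed.

Definition mod2_act (x : mod2) (g : gT) : mod2 :=
  bar (to (generic_quotient.repr x) g).

Lemma mod2_actE m g : mod2_act (bar m) g = bar (to m g).
Proof.
rewrite /mod2_act; set m' := generic_quotient.repr _.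
have /eqP/barP[n Dn] : bar m' = bar m by rewrite /bar reprK.
by apply/eqP/barP; exists (to n g); rewrite -gmodB Dn mulr2n gmodD.
Qed.

Lemma barD : {morph bar : m1 m2 / m1 + m2}.
Proof. by move=> m1 m2; rewrite /bar raddfD. Qed.

Lemma bar_surj (x : mod2) : exists m, x = bar m.
Proof. by exists (generic_quotient.repr x); rewrite /bar reprK. Qed.

Fact mod2_actD g : {morph mod2_act^~ g : x y / x + y}.
Proof.
move=> x y; have [[m ->] [n ->]] := (bar_surj x, bar_surj y).
by rewrite -barD !mod2_actE gmodD barD.
Qed.

Fact mod2_act1 x : mod2_act x 1%g = x.
Proof. by have [m ->] := bar_surj x; rewrite mod2_actE gmod1. Qed.

Fact mod2_actM x g h : mod2_act x (g * h)%g = mod2_act (mod2_act x g) h.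
Proof. by have [m ->] := bar_surj x; rewrite !mod2_actE gmodM. Qed.

Definition mod2_gmodule : gmodule gT mod2 :=
  GModule mod2_actD mod2_act1 mod2_actM.

End Cohomology.

(* s moves the i-th coordinate of a to the position s i. *)
Definition perm_rV (a : 'rV['Z_2]_5) (s : 'S_5) : 'rV['Z_2]_5 :=
  \row_j a 0 ((s^-1)%g j).

Fact perm_rV_is_action : is_action [set: 'S_5] perm_rV.
Proof.
split=> [s a b /rowP ab|a s t _ _]; apply/rowP => j.
  by have := ab (s j); rewrite !mxE permK.
by rewrite !mxE invMg permM.
Qed.
Definition perm_rV_action := Action perm_rV_is_action.

Fact perm_rV_is_groupAction : is_groupAction [set: 'rV['Z_2]_5] perm_rV_action.
Proof.
move=> s _; rewrite inE; apply/andP; split; first by apply/subsetP=> a.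
apply/morphicP => a b _ _; rewrite !actpermE /=.
by apply/rowP => j; rewrite !mxE.
Qed.
Definition perm_rV_groupAction := GroupAction perm_rV_is_groupAction.

Definition sum0_set : {set 'rV['Z_2]_5} :=
  [set a : 'rV['Z_2]_5 | \sum_i a 0 i == 0].

Fact sum0_group_set : group_set sum0_set.
Proof.
apply/group_setP; split=> [|a b]; rewrite !inE.
  by rewrite big1 // => i _; rewrite mxE.
move=> /eqP a0 /eqP b0; rewrite (eq_bigr (fun i => a 0 i + b 0 i)).
  by rewrite big_split /= a0 b0 addr0.
by move=> i _; rewrite mxE.
Qed.
Canonical sum0_group := Group sum0_group_set.

Fact sum0_acts :
  {acts [set: 'S_5], on group sum0_group | perm_rV_groupAction}.
Proof.
split; last exact: subsetT.
apply/actsP => s _ a; rewrite /= !inE; congr (_ == 0).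
rewrite (reindex_inj (@perm_inj _ s)) /=; apply: eq_bigr => j _.
by rewrite mxE permK.
Qed.

Definition W : finGroupType := sdprod_by <[sum0_acts]>%gact.

(* An element w of W is the product of its permutation followed by its sign   *)
(* change, i.e. w = sdpair2 _ (Wperm w) * sdpair1 _ (Wsign w).                *)
Definition Wperm (w : W) : 'S_5 := (val w).1.
Definition Wsign (w : W) : 'rV['Z_2]_5 := (val w).2.

Fact WpermM : {in [set: W] &, {morph Wperm : x y / (x * y)%g}}.
Proof. by []. Qed.
Canonical Wperm_morphism := Morphism WpermM.

Lemma WsignM w w' : Wsign (w * w')%g = perm_rV (Wsign w) (Wperm w') + Wsign w'.
Proof.
case: w => -[s a] sa; case: w' => -[t b] tb.
have /setXP[/= _ Ra] := sa.
by rewrite /Wsign /Wperm /= /sdprod_mul /= /actby Ra in_setT.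
Qed.

(* P (x) Q is Q^5 and [e_i] is base i; frakP_pred is the Z-span of the base i *)
(* and of their half sum.                                                     *)
Definition base (i : 'I_5) : 'rV[rat]_5 := delta_mx 0 i.

Definition frakP_gens : 6.-tuple 'rV[rat]_5 :=
  cons_tuple (2^-1 *: \sum_i base i) [tuple base i | i < 5].

Definition frakP_pred : {pred 'rV[rat]_5} :=
  [pred v | `[< inIntSpan frakP_gens v >]].

Fact frakP_zmod_closed : zmod_closed frakP_pred.
Proof.
split=> [|u v /asboolP[a ->] /asboolP[b ->]]; apply/asboolP.
  by exists [ffun=> 0]; rewrite big1 // => i _; rewrite ffunE mulr0z.
exists [ffun i => a i - b i]; rewrite -sumrB; apply: eq_bigr => i _.
by rewrite ffunE mulrzBr.
Qed.

HB.instance Definition _ := GRing.isZmodClosed.Build 'rV[rat]_5 frakP_pred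
  frakP_zmod_closed.

Record frakP := FrakP { frakP_val :> 'rV[rat]_5;
                        frakP_valP : frakP_val \in frakP_pred }.
HB.instance Definition _ := [isSub for frakP_val].
HB.instance Definition _ := [Choice of frakP by <:].
HB.instance Definition _ := [SubChoice_isSubZmodule of frakP by <:].

Lemma frakP_gen (i : 'I_6) : frakP_gens`_i \in frakP_pred.
Proof.
apply/asboolP; move: frakP_gens => s; exists [ffun k => (k == i)%:Z].
rewrite (bigD1 i) //= ffunE eqxx mulr1z big1 ?addr0 // => k /negPf ki.
by rewrite ffunE ki mulr0z.
Qed.

Lemma nth_frakP_gens (i : 'I_5) : frakP_gens`_(lift ord0 i) = base i.
Proof. by rewrite /= (nth_map i) ?size_enum_ord ?nth_ord_enum ?add0n. Qed.

Lemma base_frakP i : base i \in frakP_pred.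
Proof. by rewrite -nth_frakP_gens frakP_gen. Qed.

Lemma half_frakP : 2^-1 *: (\sum_i base i) \in frakP_pred.
Proof. exact: (frakP_gen ord0). Qed.

Definition Wact_rV (v : 'rV[rat]_5) (w : W) : 'rV[rat]_5 :=
  \row_j ((-1) ^+ Wsign w 0 j * v 0 ((Wperm w)^-1%g j)).

Lemma Wact_base i w :
  Wact_rV (base i) w = (-1) ^+ Wsign w 0 (Wperm w i) *: base (Wperm w i).
Proof.
apply/rowP => j; rewrite !mxE !eqxx /= -(inj_eq (@perm_inj _ (Wperm w))) permKV.
by case: eqP => [->|_]; rewrite ?mulr0.
Qed.

Lemma Wact_rVD w : {morph Wact_rV^~ w : u v / u + v}.
Proof. by move=> u v; apply/rowP => j; rewrite !mxE mulrDr. Qed.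

Lemma Wact_rVZ w c v : Wact_rV (c *: v) w = c *: Wact_rV v w.
Proof. by apply/rowP => j; rewrite !mxE mulrCA. Qed.

Lemma Wact_rV_sum w I (r : seq I) (P : pred I) (F : I -> 'rV[rat]_5) :
  Wact_rV (\sum_(i <- r | P i) F i) w = \sum_(i <- r | P i) Wact_rV (F i) w.
Proof.
elim/big_rec2: _ => [|i x y _ <-]; last by rewrite Wact_rVD.
by apply/rowP => j; rewrite !mxE mulr0.
Qed.

Lemma Wact_rV1 v : Wact_rV v 1%g = v.
Proof. by apply/rowP => j; rewrite !mxE /= expr0 mul1r invg1 perm1. Qed.

Lemma signZ2D (a b : 'Z_2) : (-1) ^+ (a + b)%R = (-1) ^+ a * (-1) ^+ b :> rat.
Proof. by rewrite -exprD -signr_odd /= modn2 oddb signr_odd. Qed.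

Lemma Wact_rVM v w w' : Wact_rV v (w * w')%g = Wact_rV (Wact_rV v w) w'.
Proof.
rewrite {1}/Wact_rV WsignM WpermM ?inE //; apply/rowP => j.
rewrite !mxE signZ2D invMg permM.
by rewrite mulrA [X in X * _]mulrC.
Qed.

Fact Wact_frakP (v : frakP) w : Wact_rV v w \in frakP_pred.
Proof.
case: v => _ /= /asboolP[a ->]; rewrite Wact_rV_sum; apply: rpred_sum => i _.
rewrite -scaler_int Wact_rVZ scaler_int rpredMz //.
have signP (b : 'Z_2) v : v \in frakP_pred -> (-1) ^+ b *: v \in frakP_pred.
  by move=> Pv; rewrite -signr_odd scaler_sign; case: ifP => _; rewrite ?rpredN.
case: (unliftP ord0 i) => [k ->|-> /=].
  by rewrite nth_frakP_gens Wact_base signP ?base_frakP.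
rewrite Wact_rVZ Wact_rV_sum.
have -> : \sum_k Wact_rV (base k) w = \sum_k (-1) ^+ Wsign w 0 k *: base k.
  rewrite [RHS](reindex_inj (@perm_inj _ (Wperm w))) /=.
  by apply: eq_bigr => k _; apply: Wact_base.
have -> : \sum_k (-1) ^+ Wsign w 0 k *: base k
        = \sum_k base k - 2 *: \sum_k (odd (Wsign w 0 k))%:R *: base k.
  rewrite scaler_sumr -sumrB; apply: eq_bigr => k _.
  rewrite -signr_odd scaler_sign; case: odd.
    by rewrite scale1r -[X in X - _]scale1r -scalerBl -scaleN1r.
  by rewrite scale0r scaler0 subr0.
rewrite scalerBr scalerA mulVf // scale1r rpredB ?half_frakP //.
apply: rpred_sum => k _; case: odd; first by rewrite scale1r base_frakP.
by rewrite scale0r rpred0.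
Qed.

Definition Wact (v : frakP) (w : W) : frakP := FrakP (Wact_frakP v w).

Fact WactD w : {morph Wact^~ w : u v / u + v}.
Proof. by move=> u v; apply: val_inj; apply: Wact_rVD. Qed.

Fact Wact1 v : Wact v 1%g = v.
Proof. by apply: val_inj; apply: Wact_rV1. Qed.

Fact WactM v w w' : Wact v (w * w')%g = Wact (Wact v w) w'.
Proof. by apply: val_inj; apply: Wact_rVM. Qed.

Definition frakP_gmodule : gmodule W frakP := GModule WactD Wact1 WactM.

Definition ebr (i : 'I_5) : frakP := FrakP (base_frakP i).

(* The default value 0 is never used on elements of 2 frakP. *)
Definition halve (v : frakP) : frakP := insubd 0 (2^-1 *: val v).

Lemma halveK v : halve (v *+ 2) = v.
Proof.
apply: val_inj; rewrite /halve -[X in insubd _ X]/(2^-1 *: (val v + val v)).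
rewrite -mulr2n -scaler_nat scalerA mulVf // scale1r.
by rewrite val_insubd frakP_valP.
Qed.

(* For c with bar c fixed by K, iotaPic (bar c) is the class of the cocycle   *)
(* sending x to (c . x - c) / 2; it does not depend on c, by iotaPicE.        *)
Section Connecting.

Variable K : {group W}.

Definition iotaPic_fun (c : frakP) : {ffun W -> frakP} :=
  [ffun x => if x \in K then halve (Wact c x - c) else 0].

Fact iotaPic_cocycle c :
  [forall x in K, mod2_gmodule frakP_gmodule (bar c) x == bar c] ->
  iotaPic_fun c \in cocycle_pred frakP_gmodule K.
Proof.
move/forall_inP=> Kc.
have Dc x : x \in K -> Wact c x - c = halve (Wact c x - c) *+ 2.
  move/Kc; rewrite /= mod2_actE => /barP[n /= Dn].
  by rewrite Dn halveK.
apply/cocycleP; split; last by move=> x Kx; rewrite ffunE (negPf Kx).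
move=> x y Kx Ky; rewrite !ffunE Kx Ky groupM // WactM.
rewrite -[RHS]halveK mulrnDl -Dc // [_ *+ 2]mulr2n -gmodD -mulr2n -Dc //.
by rewrite (gmodB frakP_gmodule) addrA subrK.
Qed.

Definition iotaPicZ c hc : Z1 frakP_gmodule K :=
  Cocycle (@iotaPic_cocycle c hc).

Fact H0_lift (x : H0 (mod2_gmodule frakP_gmodule) K) :
  let c : frakP := generic_quotient.repr (val x) in
  [forall g in K, mod2_gmodule frakP_gmodule (bar c) g == bar c].
Proof. by rewrite /= /bar reprK; apply: (valP x). Qed.

Definition iotaPic (x : H0 (mod2_gmodule frakP_gmodule) K) :
  H1 frakP_gmodule K :=
  cohom (iotaPicZ (H0_lift x)).

Lemma iotaPicE (x : H0 (mod2_gmodule frakP_gmodule) K) (c : frakP) hc :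
  val x = bar c -> iotaPic x = cohom (@iotaPicZ c hc).
Proof.
set c' := generic_quotient.repr (val x) => Dx.
have /eqP/barP[n Dn] : bar c' = bar c by rewrite /bar reprK.
apply/eqP/cohomP; exists n => g Kg; rewrite !ffunE Kg -/c'.
have -> : Wact c' g - c' = Wact c g - c + (Wact n g - n) *+ 2.
  have -> : c' = c + n *+ 2 by rewrite -Dn addrC subrK.
  by rewrite !mulr2n !WactD !opprD addrACA; congr (_ + _); rewrite addrACA.
have [m ->] : exists m, Wact c g - c = m *+ 2.
  by have := forall_inP hc g Kg; rewrite /= mod2_actE => /barP.
by rewrite -mulrnDl !halveK addrAC subrr add0r.
Qed.

Lemma iotaPic_2torsion x : iotaPic x *+ 2 = 0.
Proof.
set c := generic_quotient.repr (val x).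
suff: cohom (iotaPicZ (H0_lift x) *+ 2) == cohom 0.
  by move/eqP; rewrite /iotaPic /cohom raddfMn raddf0.
apply/cohomP; exists c => g Kg; rewrite mulr2n !ffunE Kg subr0 -/c -mulr2n.
have [m Dm] : exists m, Wact c g - c = m *+ 2.
  by have := forall_inP (H0_lift x) g Kg; rewrite /= mod2_actE => /barP.
by rewrite Dm halveK.
Qed.

End Connecting.

(* The pair {i, j} is an orbit of p(G), and alpha is a nonzero class of the   *)
(* form iotaPic (bar ([e_i] + [e_j])).                                        *)
Definition is_typeII (G : {group W}) (i j : 'I_5)
  (alpha : H1 frakP_gmodule G) :=
  [/\ i != j,
      orbit 'P (Wperm_morphism @* G) i = [set i; j],
      alpha != 0
    & exists2 x : H0 (mod2_gmodule frakP_gmodule) G,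
        val x = bar (ebr i + ebr j) & alpha = iotaPic x].

Definition stab (G : {group W}) (i : 'I_5) : {group W} :=
  'C_G[i | 'P \o Wperm_morphism]%G.

Lemma stab_sub G i : stab G i \subset G.
Proof. exact: subsetIl. Qed.

Lemma stabE G i w : (w \in stab G i) = (w \in G) && (Wperm w i == i).
Proof. by rewrite !inE sub1set !inE. Qed.

(* Main.v *)
Require Import Defs.
From mathcomp Require Import all_boot all_order all_algebra all_fingroup.

(* If bar c is fixed by H, the corestriction of the cocycle                   *)
(*   h |-> (c . h - c) / 2                                                    *)
(* is the cocycle g |-> (S . g - S) / 2, where S is the sum of the c . t^-1   *)
(* over representatives t of the left cosets of H in G. For c = [e_i] and H   *)
(* the stabiliser of i, the c . t^-1 are, up to signs, the [e_k] for k in the *)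
(* orbit of i, and the signs vanish modulo 2.                                 *)

Set Implicit Arguments.
Unset Strict Implicit.
Unset Printing Implicit Defensive.

Import GRing.Theory.
Local Open Scope ring_scope.

(** Corestriction commutes with the connecting homomorphisms, acting as the trace on invariants
    modulo 2 ([cores_iotaPic]). The trace of [e_i] from its stabiliser is the orbit sum
    ([bar_trace_stab]), here [e_i] + [e_j]; the index is the orbit size, 2. *)

Lemma iotaPic_funK (K : {group W}) c x :
    [forall g in K, mod2_gmodule frakP_gmodule (bar c) g == bar c] ->
  x \in K -> iotaPic_fun K c x *+ 2 = Wact c x - c.
Proof.
move=> /forall_inP Kc Kx; have := Kc x Kx.
by rewrite ffunE Kx /= mod2_actE => /barP[n /= ->]; rewrite halveK.
Qed.

(** This lift depends on the chosen representatives; when [bar c] is fixed by [H], its class modulo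
    2 does not. *)
Definition trace_lift (H G : {group W}) (c : frakP) : frakP :=
  \sum_(C in lcosets H G) Wact c (fingroup.repr C)^-1%g.

(** If g t = t' h, then h t^-1 = t'^-1 g, so the doubled term at t is c . (t'^-1 g) - c . t^-1; and
    t' runs over all representatives as t does. *)
Lemma cores_iotaPicZ (H G : {group W}) c hc g : g \in G ->
  coresZ G (@iotaPicZ H c hc) g *+ 2
    = Wact (trace_lift H G c) g - trace_lift H G c.
Proof.
move=> Gg; rewrite ffunE Gg -sumrMnl [Wact _ g](gmod_sum frakP_gmodule).
rewrite -[X in _ = X - _](sum_lcosetsM _ _ Gg) -sumrB.
apply: eq_bigr => C GC; set t := fingroup.repr C.
have -> : fingroup.repr (g *: C)%g = lrep H (g * t).
  by rewrite -{1}(lcosets_repr GC) -lcosetM.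
rewrite /= mulr2n -(gmodD frakP_gmodule) -mulr2n.
rewrite iotaPic_funK ?lrepV_mem // (gmodB frakP_gmodule) /=.
by rewrite -!WactM !mulgA mulgK.
Qed.

Lemma cores_iotaPic (H G : {group W})
    (x : H0 (mod2_gmodule frakP_gmodule) H)
    (y : H0 (mod2_gmodule frakP_gmodule) G) (c : frakP) :
  val x = bar c -> val y = bar (trace_lift H G c) ->
  cores G (iotaPic x) = iotaPic y.
Proof.
move=> Dx Dy.
have hc : [forall g in H, mod2_gmodule frakP_gmodule (bar c) g == bar c].
  by rewrite -Dx; apply: (valP x).
have hS : [forall g in G, mod2_gmodule frakP_gmodule
             (bar (trace_lift H G c)) g == bar (trace_lift H G c)].
  by rewrite -Dy; apply: (valP y).
rewrite (iotaPicE hc Dx) (iotaPicE hS Dy) coresE; congr cohom.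
apply/val_inj/ffunP => g; case Gg: (g \in G); last by rewrite !ffunE Gg.
(* Doubling is injective on [frakP], so the cocycles are equal, not just cohomologous. *)
by apply: (can_inj halveK); rewrite cores_iotaPicZ // iotaPic_funK.
Qed.

Lemma bar_sum (I : Type) (r : seq I) (P : pred I) (F : I -> frakP) :
  bar (\sum_(k <- r | P k) F k) = \sum_(k <- r | P k) bar (F k).
Proof. by rewrite /bar raddf_sum. Qed.

(** Signs vanish modulo 2, as -e - e = 2(-e). *)
Lemma bar_Wact_ebr i w : bar (Wact (ebr i) w) = bar (ebr (Wperm w i)).
Proof.
apply/eqP/barP; case E: (odd (Wsign w 0 (Wperm w i))).
  exists (- ebr (Wperm w i)); apply: val_inj.
  by rewrite /= Wact_base -signr_odd E scaleN1r.
exists 0; rewrite mul0rn; apply: val_inj.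
by rewrite /= Wact_base -signr_odd E scale1r subrr.
Qed.

Lemma orbit_Wperm (G : {group W}) i :
  orbit 'P (Wperm_morphism @* G) i = orbit ('P \o Wperm_morphism) G i.
Proof.
apply/setP => k; apply/orbitP/orbitP => [[_ /morphimP[w _ Gw ->] <-]|[w Gw <-]].
  by exists w.
by exists (Wperm w) => //; apply: mem_morphim; rewrite ?inE.
Qed.

Lemma index_stab (G : {group W}) i :
  #|G : stab G i|%g = #|orbit 'P (Wperm_morphism @* G) i|.
Proof.
by rewrite orbit_Wperm card_orbit_in //; apply/subsetP => w _; rewrite !inE.
Qed.

Lemma stab_fix (G : {group W}) i :
  [forall g in stab G i, mod2_gmodule frakP_gmodule (bar (ebr i)) g
                           == bar (ebr i)].
Proof.
apply/forall_inP => g; rewrite stabE => /andP[_ /eqP gi].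
by rewrite /= mod2_actE /= bar_Wact_ebr gi.
Qed.

(** Orbit-stabiliser: tH goes bijectively to the image of i under t^-1. The inverse appears because
    the action is on the right while the cosets are left cosets. *)
Lemma bar_trace_stab (G : {group W}) i :
  bar (trace_lift (stab G i) G (ebr i))
    = \sum_(k in orbit 'P (Wperm_morphism @* G) i) bar (ebr k).
Proof.
pose f (C : {set W}) := Wperm (fingroup.repr C)^-1%g i.
(* The representative is x h with h fixing i, so h does not affect the value. *)
have fE x : x \in G -> f (x *: stab G i)%g = Wperm x^-1%g i.
  move=> Gx; have [h] := lrepP (stab G i) x.
  rewrite /f /lrep -groupV stabE => /andP[_ /eqP hi] ->.
  by rewrite invMg WpermM ?inE // permM hi.
rewrite orbit_Wperm bar_sum.
under eq_bigr do rewrite bar_Wact_ebr -/(f _).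
have -> : orbit ('P \o Wperm_morphism) G i = f @: lcosets (stab G i) G.
  apply/setP => k; apply/orbitP/imsetP => [[w Gw <-]|[_ /lcosetsP[x Gx ->] ->]].
    exists (w^-1 *: stab G i)%g; last by rewrite fE ?groupV // invgK.
    by apply/lcosetsP; exists w^-1%g; rewrite ?groupV.
  by exists x^-1%g; rewrite ?groupV ?fE.
rewrite [RHS]big_imset //= => _ _ /lcosetsP[x Gx ->] /lcosetsP[y Gy ->].
rewrite !fE // => xy; apply/eqP; rewrite eq_sym; apply/eqP/lcoset_eqP.
rewrite mem_lcoset stabE groupM ?groupV //=.
by rewrite WpermM ?inE // permM xy -permM -WpermM ?inE // mulVg perm1.
Qed.

Theorem lemma5p16 (G : {group W}) (i j : 'I_5) (alpha : H1 frakP_gmodule G)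
    (typeII_alpha : is_typeII i j alpha) :
  (stab G i \subset G /\ #|G : stab G i|%g = 2%N)
  /\ (exists2 x : H0 (mod2_gmodule frakP_gmodule) (stab G i),
        val x = bar (ebr i) & alpha = cores G (iotaPic x)).
Proof.
case: typeII_alpha => neq_ij orb_i _ [y Dy ->]; split.
  by rewrite stab_sub index_stab orb_i cards2 neq_ij.
exists (exist _ (bar (ebr i)) (stab_fix G i)) => //.
symmetry; apply: (@cores_iotaPic _ _ _ _ (ebr i)) => //.
by rewrite Dy bar_trace_stab orb_i big_setU1 ?inE //= big_set1 barD.
Qed.
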